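(* Let $d$ be an integer with $d\ge 6$ and $d\equiv 2\pmod 4$, put $d'=\lfloor d/4\rfloor$, let $k$ be a rational and $\varepsilon$ a positive real such that $$2\le k<2+\frac{1}{2d'}\qquad\text{and}\qquad \varepsilon\sum_{j=0}^{d'-1}(k-1)^{2j+1}\ \ge\ \frac{1}{k+\varepsilon}.$$ If $G$ is a fractionally $k$-colorable graph and $W\subseteq V(G)$ is a set of vertices at pairwise distance at least $d$, then every fractional $(k+\varepsilon)$-precoloring of $W$ extends to a fractional $(k+\varepsilon)$-coloring of $G$.
   Context: A fractional $m$-coloring of a graph (real $m>0$) assigns to each vertex a measurable subset of $[0,m)$ of Lebesgue measure one so that adjacent vertices receive disjoint sets; a graph is fractionally $k$-colorable if it has a fractional $k$-coloring. A fractional $m$-precoloring of a vertex set $W$ assigns measurable subsets of $[0,m)$ of measure one to the vertices of $W$; it extends if some fractional $m$-coloring of the whole graph agrees with it on $W$. Graphs are finite. *)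

(* Defs.v *)
From Stdlib Require Import Reals QArith Qreals List Lia.
Open Scope R_scope.

Definition Rset := R -> Prop.

Definition cover_sum (A : Rset) (s : R) : Prop :=
  exists a b : nat -> R,
    (forall n, a n <= b n) /\
    (forall x, A x -> exists n, a n <= x < b n) /\
    infinite_sum (fun n => b n - a n) s.

Definition lebesgue_outer (A : Rset) (x : R) : Prop :=
  (forall s, cover_sum A s -> x <= s) /\
  (forall y, (forall s, cover_sum A s -> y <= s) -> y <= x) /\
  (exists s, cover_sum A s).

(* Lebesgue measurability via Caratheodory's criterion (test sets of finite
   outer measure suffice). *)
Definition lebesgue_measurable (A : Rset) : Prop :=
  forall (E : Rset) (x : R), lebesgue_outer E x ->
    exists y z, lebesgue_outer (fun t => E t /\ A t) y /\
                lebesgue_outer (fun t => E t /\ ~ A t) z /\ x = y + z.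

Definition unit_subset (m : R) (A : Rset) : Prop :=
  (forall t, A t -> 0 <= t < m) /\ lebesgue_measurable A /\ lebesgue_outer A 1.

Record graph := {
  vtx : Type;
  adj : vtx -> vtx -> Prop;
  adj_sym : forall u v, adj u v -> adj v u;
  adj_irrefl : forall u, ~ adj u u;
  vtx_finite : exists l : list vtx, forall v, In v l
}.

Definition disjoint (A B : Rset) : Prop := forall t, ~ (A t /\ B t).

Definition fractional_coloring (G : graph) (m : R) (c : vtx G -> Rset) : Prop :=
  (forall v, unit_subset m (c v)) /\
  (forall u v, adj G u v -> disjoint (c u) (c v)).

Definition fractionally_colorable (G : graph) (k : R) : Prop :=
  exists c, fractional_coloring G k c.

Definition fractional_precoloring (G : graph) (m : R) (W : vtx G -> Prop)
  (f : vtx G -> Rset) : Prop :=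
  forall v, W v -> unit_subset m (f v).

Definition precoloring_extends (G : graph) (m : R) (W : vtx G -> Prop)
  (f : vtx G -> Rset) : Prop :=
  exists c, fractional_coloring G m c /\
    (forall v, W v -> forall t, c v t <-> f v t).

Inductive walk (G : graph) : vtx G -> vtx G -> nat -> Prop :=
| walk0 : forall u, walk G u u 0
| walkS : forall u w v n, adj G u w -> walk G w v n -> walk G u v (S n).

(* dist(u,v) >= d  (disconnected vertices have infinite distance) *)
Definition dist_ge (G : graph) (u v : vtx G) (d : nat) : Prop :=
  forall n, walk G u v n -> (d <= n)%nat.

(* Main.v *)
From Stdlib Require Import Lra Wf_nat Classical ClassicalEpsilon.
From Stdlib Require Import FunctionalExtensionality PropExtensionality.
From Coquelicot Require Import Coquelicot.
From Stdlib Require Import Reals QArith Qreals List Lia.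
Require Import Defs.
Open Scope R_scope.

(** Write [n = d / 4], so that [d = 4 n + 2].  An odd closed walk of length
    [2 i + 1] forces [k >= 2 + 1 / i], so for [k < 2 + 1 / (2 n)] no edge joins two
    vertices at the same distance at most [2 n] from a vertex of [W], and the balls
    of radius [2 n] around [W] are disjoint and not joined by edges.  Far from [W]
    one uses a copy of the given [k]-colouring that is independent of all precolour
    sets; a fraction [1 / (k + eps)] of each of its colour sets then lies in the
    set [X] of a precoloured vertex [w].  Inside the ball of [w] the vertices next to
    [w] must avoid [X].  Going inwards, the spare colours (measure [eps]) let the
    vertices at even distance release colours outside [X] with density [eps]; each
    set at odd distance gains [(k - 1) eps] from them and can release as much of [X];
    this in turn lets the even ones release density [eps + (k - 1)^2 eps], and so on.
    After [n] rounds the odd side has released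
    [eps * sum_(j < n) (k - 1)^(2 j + 1) >= 1 / (k + eps)], that is, all of [X]. *)

(** * Lebesgue outer measure *)

Definition full : Rset := fun _ => True.
Definition cap (A B : Rset) : Rset := fun t => A t /\ B t.
Definition cup (A B : Rset) : Rset := fun t => A t \/ B t.
Definition diff (A B : Rset) : Rset := fun t => A t /\ ~ B t.
Definition subset (A B : Rset) : Prop := forall t, A t -> B t.
Definition finite_outer (A : Rset) : Prop := exists s, cover_sum A s.

Ltac set_unfold :=
  unfold subset, disjoint, full, cap, cup, diff in *.

Lemma set_ext (A B : Rset) : (forall t, A t <-> B t) -> A = B.
Proof.
  intros H. apply functional_extensionality; intro t.
  apply propositional_extensionality, H.
Qed.

Ltac set_solve :=
  set_unfold;
  first [ apply set_ext; let t := fresh "t" in intro t; apply NNPP; tauto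
        | let t := fresh "t" in intro t; apply NNPP; tauto
        | intuition ].

Lemma infinite_sum_intro (u : nat -> R) (l : R) :
  (forall n, 0 <= u n) ->
  (forall N, sum_f_R0 u N <= l) ->
  (forall e, 0 < e -> exists N, l - e < sum_f_R0 u N) ->
  infinite_sum u l.
Proof.
  intros Hu Hle Hex e He. destruct (Hex e He) as [N HN].
  exists N. intros n Hn. unfold Rdist.
  assert (sum_f_R0 u N <= sum_f_R0 u n).
  { induction Hn; [lra|]. simpl. specialize (Hu (S m)). lra. }
  specialize (Hle n). rewrite Rabs_left1; lra.
Qed.

Lemma infinite_sum_ge_partial (u : nat -> R) (l : R) (N : nat) :
  (forall n, 0 <= u n) -> infinite_sum u l -> sum_f_R0 u N <= l.
Proof. intros Hu H. apply sum_incr; [exact H | exact Hu]. Qed.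

Lemma cover_sum_nonneg (A : Rset) (s : R) : cover_sum A s -> 0 <= s.
Proof.
  intros [a [b [Hab [_ Hs]]]].
  apply Rle_trans with (sum_f_R0 (fun n => b n - a n) 0).
  - simpl. specialize (Hab 0%nat). lra.
  - apply infinite_sum_ge_partial; [|exact Hs].
    intro n. specialize (Hab n). lra.
Qed.

Lemma cover_sum_subset (A B : Rset) (s : R) :
  subset A B -> cover_sum B s -> cover_sum A s.
Proof.
  intros H [a [b [Hab [Hc Hs]]]]. exists a, b. repeat split; auto.
Qed.

Lemma finite_outer_subset (A B : Rset) :
  subset A B -> finite_outer B -> finite_outer A.
Proof. intros H [s Hs]. exists s. eapply cover_sum_subset; eauto. Qed.

(** Serves twice: to enumerate two covers in one sequence, and to alternate the two kinds of
    palettes in [palette_exists]. *)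
Definition interleave {T : Type} (u v : nat -> T) (n : nat) : T :=
  if Nat.even n then u (Nat.div2 n) else v (Nat.div2 n).

Lemma interleave_even {T : Type} (u v : nat -> T) (n : nat) : interleave u v (2 * n) = u n.
Proof. unfold interleave. rewrite Nat.even_even, Nat.div2_double. reflexivity. Qed.

Lemma interleave_odd {T : Type} (u v : nat -> T) (n : nat) : interleave u v (S (2 * n)) = v n.
Proof.
  unfold interleave. rewrite Nat.div2_succ_double.
  replace (S (2 * n)) with (2 * n + 1)%nat by lia.
  rewrite Nat.even_odd. reflexivity.
Qed.

Lemma sum_interleave (u v : nat -> R) (N : nat) :
  sum_f_R0 (interleave u v) (S (2 * N)) = sum_f_R0 u N + sum_f_R0 v N.
Proof.
  induction N as [|N IH].
  - simpl. unfold interleave; simpl. reflexivity.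
  - replace (S (2 * S N)) with (S (S (S (2 * N)))) by lia.
    do 2 rewrite tech5. rewrite IH.
    replace (S (S (S (2 * N)))) with (S (2 * S N)) by lia.
    replace (S (S (2 * N))) with (2 * S N)%nat by lia.
    rewrite interleave_odd, interleave_even, !tech5. ring.
Qed.

Lemma sum_f_R0_mono (u : nat -> R) (m n : nat) :
  (forall i, 0 <= u i) -> (m <= n)%nat -> sum_f_R0 u m <= sum_f_R0 u n.
Proof.
  intros Hu Hn. induction Hn; [lra|]. simpl. specialize (Hu (S m0)). lra.
Qed.

Lemma cover_sum_cup (A B : Rset) (s r : R) :
  cover_sum A s -> cover_sum B r -> cover_sum (cup A B) (s + r).
Proof.
  intros [a [b [Hab [Hc Hs]]]] [a' [b' [Hab' [Hc' Hs']]]].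
  exists (interleave a a'), (interleave b b').
  assert (Hle : forall n, interleave a a' n <= interleave b b' n).
  { intro n. unfold interleave. destruct (Nat.even n); auto. }
  assert (E : (fun n => interleave b b' n - interleave a a' n) =
              interleave (fun n => b n - a n) (fun n => b' n - a' n)).
  { apply functional_extensionality; intro n. unfold interleave.
    destruct (Nat.even n); reflexivity. }
  split; [exact Hle|]. split.
  - intros x [Hx|Hx].
    + destruct (Hc x Hx) as [n Hn]. exists (2 * n)%nat.
      rewrite !interleave_even. exact Hn.
    + destruct (Hc' x Hx) as [n Hn]. exists (S (2 * n)).
      rewrite !interleave_odd. exact Hn.
  - assert (Hp : forall n, 0 <= b n - a n) by (intro n; specialize (Hab n); lra).
    assert (Hp' : forall n, 0 <= b' n - a' n) by (intro n; specialize (Hab' n); lra).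
    assert (Hpi : forall n, 0 <= interleave (fun n => b n - a n) (fun n => b' n - a' n) n).
    { intro n. unfold interleave. destruct (Nat.even n); auto. }
    rewrite E. apply infinite_sum_intro; [exact Hpi| |].
    + intro N.
      apply Rle_trans with
        (sum_f_R0 (interleave (fun n => b n - a n) (fun n => b' n - a' n)) (S (2 * N))).
      * apply sum_f_R0_mono; [exact Hpi | lia].
      * rewrite sum_interleave.
        apply Rplus_le_compat; apply infinite_sum_ge_partial; auto.
    + intros e He.
      destruct (Hs (e / 2)) as [N1 H1]; [lra|].
      destruct (Hs' (e / 2)) as [N2 H2]; [lra|].
      set (N := Nat.max N1 N2).
      (* An odd last index takes equally many terms of both series. *)
      exists (S (2 * N)). rewrite sum_interleave.
      specialize (H1 N ltac:(unfold N; lia)). specialize (H2 N ltac:(unfold N; lia)).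
      unfold Rdist in *. apply Rabs_def2 in H1. apply Rabs_def2 in H2. lra.
Qed.

Lemma cover_sum_interval (x y : R) :
  x <= y -> cover_sum (fun t => x <= t < y) (y - x).
Proof.
  (* All intervals after the first are empty. *)
  intro H. exists (fun n => match n with O => x | _ => y end), (fun _ => y).
  split; [intros [|n]; lra|]. split.
  - intros t Ht. exists 0%nat. exact Ht.
  - intros e He. exists 0%nat. intros n _.
    replace (sum_f_R0 _ n) with (y - x).
    + unfold Rdist. rewrite Rminus_diag, Rabs_R0. exact He.
    + induction n as [|n IH]; simpl; [reflexivity|]. rewrite <- IH. ring.
Qed.

Lemma lebesgue_outer_exists (A : Rset) :
  finite_outer A -> exists x, lebesgue_outer A x.
Proof.
  intros [s0 Hs0].
  (* [completeness] yields suprema, so the infimum of the cover sums is obtained by negation. *)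
  destruct (completeness (fun y => cover_sum A (- y))) as [m [Hub Hlub]].
  - exists 0. intros y Hy. apply cover_sum_nonneg in Hy. lra.
  - exists (- s0). rewrite Ropp_involutive. exact Hs0.
  - exists (- m). split; [|split].
    + intros s Hs. enough (- s <= m) by lra.
      apply Hub. rewrite Ropp_involutive. exact Hs.
    + intros y Hy. enough (m <= - y) by lra.
      apply Hlub. intros z Hz. specialize (Hy _ Hz). lra.
    + exists s0. exact Hs0.
Qed.

(* Meaningful only for sets of finite outer measure. *)
Definition mu (A : Rset) : R := epsilon (inhabits 0) (lebesgue_outer A).

Lemma mu_spec (A : Rset) : finite_outer A -> lebesgue_outer A (mu A).
Proof. intro H. unfold mu. apply epsilon_spec, lebesgue_outer_exists, H. Qed.

Lemma lebesgue_outer_mu (A : Rset) (x : R) :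
  lebesgue_outer A x <-> finite_outer A /\ x = mu A.
Proof.
  split.
  - intros [H1 [H2 H3]]. split; [exact H3|].
    destruct (mu_spec A H3) as [H1' [H2' _]]. apply Rle_antisym; auto.
  - intros [H ->]. apply mu_spec, H.
Qed.

Lemma mu_le (A B : Rset) : subset A B -> finite_outer B -> mu A <= mu B.
Proof.
  intros H HB. destruct (mu_spec B HB) as [_ [H2 _]]. apply H2.
  intros s Hs. destruct (mu_spec A (finite_outer_subset _ _ H HB)) as [H1 _].
  apply H1. eapply cover_sum_subset; eauto.
Qed.

Lemma mu_nonneg (A : Rset) : finite_outer A -> 0 <= mu A.
Proof.
  intro H. destruct (mu_spec A H) as [_ [H2 _]]. apply H2, cover_sum_nonneg.
Qed.

Lemma finite_outer_cup (A B : Rset) :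
  finite_outer A -> finite_outer B -> finite_outer (cup A B).
Proof. intros [s Hs] [r Hr]. exists (s + r). apply cover_sum_cup; auto. Qed.

Lemma mu_cup_le (A B : Rset) :
  finite_outer A -> finite_outer B -> mu (cup A B) <= mu A + mu B.
Proof.
  intros HA HB.
  destruct (mu_spec _ (finite_outer_cup _ _ HA HB)) as [H1 _].
  (* The infimum property is applied to one set at a time, with the other term moved to the left. *)
  enough (mu (cup A B) - mu B <= mu A) by lra.
  apply (mu_spec A HA). intros s Hs.
  enough (mu (cup A B) - s <= mu B) by lra.
  apply (mu_spec B HB). intros r Hr.
  enough (mu (cup A B) <= s + r) by lra.
  apply H1, cover_sum_cup; auto.
Qed.

Lemma finite_outer_interval (x y : R) : finite_outer (fun t => x <= t < y).
Proof.
  destruct (Rle_dec x y) as [H|H].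
  - exists (y - x). apply cover_sum_interval, H.
  - apply finite_outer_subset with (fun t => x <= t < x); [intros t Ht; lra|].
    exists (x - x). apply cover_sum_interval. lra.
Qed.

Lemma clip_term_nonneg (a b t : R) : a <= b -> 0 <= Rmin b t - Rmin a t <= b - a.
Proof.
  intro H. unfold Rmin. destruct (Rle_dec a t), (Rle_dec b t); lra.
Qed.

(* Each covering interval is cut at [t]; the pieces cover the two halves. *)
Lemma cover_sum_halfline (A : Rset) (s t : R) :
  cover_sum A s ->
  exists s1, cover_sum (fun x => A x /\ x < t) s1 /\
             cover_sum (fun x => A x /\ ~ x < t) (s - s1).
Proof.
  intros [a [b [Hab [Hc Hs]]]].
  (* The clipped lengths are dominated by the original ones; the upper pieces are then summed as a
     difference of convergent series. *)
  assert (Hx : ex_series (fun n => Rmin (b n) t - Rmin (a n) t)).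
  { apply (@ex_series_le R_AbsRing R_CompleteNormedModule _ (fun n => b n - a n)).
    - intro n. change (Rabs (Rmin (b n) t - Rmin (a n) t) <= b n - a n).
      destruct (clip_term_nonneg _ _ t (Hab n)). rewrite Rabs_right; lra.
    - exists s. apply is_series_Reals, Hs. }
  destruct Hx as [s1 Hs1]. exists s1. split.
  - exists (fun n => Rmin (a n) t), (fun n => Rmin (b n) t). split; [|split].
    + intro n. destruct (clip_term_nonneg _ _ t (Hab n)). lra.
    + intros x [HA Hx]. destruct (Hc x HA) as [n Hn]. exists n.
      unfold Rmin. destruct (Rle_dec (a n) t), (Rle_dec (b n) t); lra.
    + apply is_series_Reals, Hs1.
  - exists (fun n => Rmax (a n) t), (fun n => Rmax (b n) t). split; [|split].
    + intro n. specialize (Hab n). unfold Rmax.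
      destruct (Rle_dec (a n) t), (Rle_dec (b n) t); lra.
    + intros x [HA Hx]. destruct (Hc x HA) as [n Hn]. exists n.
      unfold Rmax. destruct (Rle_dec (a n) t), (Rle_dec (b n) t); lra.
    + apply is_series_Reals.
      apply is_series_ext with
        (fun n => minus (b n - a n) (Rmin (b n) t - Rmin (a n) t)).
      * intro n. change (b n - a n - (Rmin (b n) t - Rmin (a n) t) =
                         Rmax (b n) t - Rmax (a n) t).
        unfold Rmin, Rmax. destruct (Rle_dec (a n) t), (Rle_dec (b n) t); lra.
      * apply (is_series_minus _ _ s s1); [apply is_series_Reals, Hs | exact Hs1].
Qed.

(* [g y] is the total length of the covering intervals below [y]; it grows with
   slope at least one at every covered point, so the supremum of the points
   where [g y >= y] is the right end point. *)
Lemma cover_sum_ge_length (x s : R) :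
  0 <= x -> cover_sum (fun t => 0 <= t < x) s -> x <= s.
Proof.
  intros Hx [a [b [Hab [Hc Hs]]]].
  (* For [y >= 0], this is the length of the part of the [n]-th interval inside [[0, y)]. *)
  set (g := fun y n => Rmin (Rmax (b n) 0) y - Rmin (Rmax (a n) 0) y).
  assert (Hab0 : forall n, Rmax (a n) 0 <= Rmax (b n) 0).
  { intro n. specialize (Hab n). unfold Rmax.
    destruct (Rle_dec (a n) 0), (Rle_dec (b n) 0); lra. }
  assert (Hab1 : forall n, Rmax (b n) 0 - Rmax (a n) 0 <= b n - a n).
  { intro n. specialize (Hab n). unfold Rmax.
    destruct (Rle_dec (a n) 0), (Rle_dec (b n) 0); lra. }
  assert (Hg0 : forall y n, 0 <= g y n <= b n - a n).
  { intros y n. specialize (Hab1 n).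
    pose proof (clip_term_nonneg _ _ y (Hab0 n)). unfold g. lra. }
  assert (Hgm : forall y z n, y <= z -> g y n <= g z n).
  { intros y z n Hyz. specialize (Hab0 n). unfold g, Rmin.
    destruct (Rle_dec (Rmax (b n) 0) y), (Rle_dec (Rmax (a n) 0) y),
      (Rle_dec (Rmax (b n) 0) z), (Rle_dec (Rmax (a n) 0) z); lra. }
  (* Partial sums with an error [e] stand for the infinite sum of [g y] being at least [y]. *)
  set (P := fun y => 0 <= y <= x /\
                     forall e, 0 < e -> exists N, y - e <= sum_f_R0 (g y) N).
  destruct (completeness P) as [m [Hub Hlub]].
  - exists x. intros y [Hy _]. lra.
  - exists 0. split; [lra|]. intros e He. exists 0%nat. simpl.
    destruct (Hg0 0 0%nat). lra.
  - assert (Hm : 0 <= m <= x).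
    { split.
      - apply Hub. split; [lra|]. intros e He. exists 0%nat. simpl.
        destruct (Hg0 0 0%nat). lra.
      - apply Hlub. intros y [Hy _]. lra. }
    (* The supremum is attained: points of [P] come within [e / 2] of [m], and [g] is monotone in
       its first argument. *)
    assert (HPm : P m).
    { split; [exact Hm|]. intros e He.
      destruct (classic (exists y, P y /\ m - e / 2 < y)) as [[y [[Hy HP] Hlt]]|Hno].
      - destruct (HP (e / 2)) as [N HN]; [lra|]. exists N.
        apply Rle_trans with (sum_f_R0 (g y) N); [lra|].
        apply sum_Rle. intros n _. apply Hgm, Hub. split; auto.
      - exfalso. enough (m <= m - e / 2) by lra.
        apply Hlub. intros y Hy. apply Rnot_lt_le. intro. apply Hno. eauto. }
    assert (m = x) as ->.
    { apply NNPP. intro Hne.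
      destruct (Hc m) as [n Hn]; [lra|].
      (* The interval that covers [m] carries [P] beyond [m], up to its own end or [x], against the
         choice of [m]. *)
      set (z := Rmin (b n) x).
      assert (Hz : m < z <= x /\ z <= b n)
        by (unfold z, Rmin; destruct (Rle_dec (b n) x); lra).
      enough (P z) as Hpz by (apply Hub in Hpz; lra).
      split; [lra|]. intros e He.
      destruct HPm as [_ HP]. destruct (HP e He) as [N HN].
      set (N' := Nat.max N n). exists N'.
      assert (HN' : m - e <= sum_f_R0 (g m) N').
      { apply Rle_trans with (1 := HN).
        apply sum_f_R0_mono; [intro; apply Hg0 | unfold N'; lia]. }
      enough (sum_f_R0 (g m) N' + (z - m) <= sum_f_R0 (g z) N') by lra.
      assert (Hn' : (n <= N')%nat) by (unfold N'; lia).
      assert (Hstep : g m n + (z - m) <= g z n).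
      { unfold g.
        assert (Rmax (a n) 0 <= m) by (unfold Rmax; destruct (Rle_dec (a n) 0); lra).
        assert (z <= Rmax (b n) 0) by (pose proof (Rmax_l (b n) 0); lra).
        rewrite !(Rmin_right (Rmax (b n) 0)), !(Rmin_left (Rmax (a n) 0)); lra. }
      clear - Hn' Hstep Hgm Hz.
      induction N' as [|N' IH].
      - replace n with 0%nat in * by lia. simpl. lra.
      - simpl. destruct (Nat.eq_dec n (S N')) as [->|Hd].
        + enough (sum_f_R0 (g m) N' <= sum_f_R0 (g z) N') by lra.
          apply sum_Rle. intros i _. apply Hgm. lra.
        + pose proof (Hgm m z (S N')).
          assert (n <= N')%nat as Hl by lia. specialize (IH Hl). lra. }
    apply le_epsilon. intros e He. destruct HPm as [_ HP].
    destruct (HP e He) as [N HN].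
    enough (sum_f_R0 (g x) N <= s) by lra.
    apply Rle_trans with (sum_f_R0 (fun n => b n - a n) N).
    + apply sum_Rle. intros n _. apply Hg0.
    + apply infinite_sum_ge_partial; [|exact Hs].
      intro n. specialize (Hab n). lra.
Qed.

Lemma mu_interval (x : R) : 0 <= x -> mu (fun t => 0 <= t < x) = x.
Proof.
  intro H. symmetry. apply lebesgue_outer_mu.
  split; [|split].
  - intros s Hs. apply cover_sum_ge_length; auto.
  - intros y Hy. rewrite <- (Rminus_0_r x). apply Hy, cover_sum_interval, H.
  - exists (x - 0). apply cover_sum_interval, H.
Qed.

(** * Caratheodory measurability in terms of [mu] *)

Lemma measurable_iff (A : Rset) :
  lebesgue_measurable A <->
  forall E, finite_outer E -> mu E = mu (cap E A) + mu (diff E A).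
Proof.
  split.
  - intros H E HE. destruct (H E (mu E) (mu_spec E HE)) as [y [z [Hy [Hz Heq]]]].
    apply lebesgue_outer_mu in Hy. apply lebesgue_outer_mu in Hz.
    destruct Hy as [_ ->], Hz as [_ ->]. exact Heq.
  - intros H E x Hx. apply lebesgue_outer_mu in Hx. destruct Hx as [HE ->].
    exists (mu (cap E A)), (mu (diff E A)). split; [|split].
    + apply mu_spec, finite_outer_subset with E; [set_solve|exact HE].
    + apply mu_spec, finite_outer_subset with E; [set_solve|exact HE].
    + apply H, HE.
Qed.

Lemma mu_split (A E : Rset) :
  lebesgue_measurable A -> finite_outer E -> mu E = mu (cap E A) + mu (diff E A).
Proof. intros H. apply measurable_iff, H. Qed.

Lemma measurable_compl (A : Rset) :
  lebesgue_measurable A -> lebesgue_measurable (diff full A).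
Proof.
  intro H. apply measurable_iff. intros E HE. rewrite (mu_split A E H HE).
  replace (cap E (diff full A)) with (diff E A) by set_solve.
  replace (diff E (diff full A)) with (cap E A) by set_solve. ring.
Qed.

(** Cut [E] by [A] and its inner part by [B]; cutting the complement of the intersection by [A]
    yields the other two of the resulting three pieces. *)
Lemma measurable_cap (A B : Rset) :
  lebesgue_measurable A -> lebesgue_measurable B -> lebesgue_measurable (cap A B).
Proof.
  intros HA HB. apply measurable_iff. intros E HE.
  assert (HEA : finite_outer (cap E A)) by (apply finite_outer_subset with E; [set_solve|auto]).
  assert (HEd : finite_outer (diff E (cap A B)))
    by (apply finite_outer_subset with E; [set_solve|auto]).
  rewrite (mu_split A E HA HE), (mu_split B _ HB HEA), (mu_split A _ HA HEd).
  replace (cap (cap E A) B) with (cap E (cap A B)) by set_solve.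
  replace (cap (diff E (cap A B)) A) with (diff (cap E A) B) by set_solve.
  replace (diff (diff E (cap A B)) A) with (diff E A) by set_solve. ring.
Qed.

Lemma measurable_diff (A B : Rset) :
  lebesgue_measurable A -> lebesgue_measurable B -> lebesgue_measurable (diff A B).
Proof.
  intros HA HB. replace (diff A B) with (cap A (diff full B)) by set_solve.
  apply measurable_cap; [exact HA | apply measurable_compl, HB].
Qed.

Lemma measurable_cup (A B : Rset) :
  lebesgue_measurable A -> lebesgue_measurable B -> lebesgue_measurable (cup A B).
Proof.
  intros HA HB.
  replace (cup A B) with (diff full (cap (diff full A) (diff full B))) by set_solve.
  auto using measurable_compl, measurable_cap.
Qed.

Lemma mu_empty (A : Rset) : (forall t, ~ A t) -> mu A = 0.
Proof.
  intro H. replace A with (fun t => 0 <= t < 0).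
  - apply mu_interval. lra.
  - apply set_ext. intro t. specialize (H t). split; [lra|tauto].
Qed.

Lemma measurable_empty (A : Rset) : (forall t, ~ A t) -> lebesgue_measurable A.
Proof.
  intro H. apply measurable_iff. intros E HE.
  rewrite (mu_empty (cap E A)) by (intros t [_ Ht]; exact (H t Ht)).
  replace (diff E A) with E; [ring|].
  apply set_ext. intro t. specialize (H t). set_unfold. tauto.
Qed.

Lemma measurable_full : lebesgue_measurable full.
Proof.
  replace full with (diff full (fun t => False)) by set_solve.
  apply measurable_compl, measurable_empty. tauto.
Qed.

(** One inequality is subadditivity; for the other, every cover of [E] is cut at [t] without
    changing its total length. *)
Lemma measurable_halfline (t : R) : lebesgue_measurable (fun x => x < t).
Proof.
  apply measurable_iff. intros E HE.
  assert (H1 : finite_outer (cap E (fun x => x < t)))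
    by (apply finite_outer_subset with E; [set_solve|auto]).
  assert (H2 : finite_outer (diff E (fun x => x < t)))
    by (apply finite_outer_subset with E; [set_solve|auto]).
  apply Rle_antisym.
  - replace E with (cup (cap E (fun x => x < t)) (diff E (fun x => x < t))) at 1
      by set_solve.
    apply mu_cup_le; auto.
  - apply (mu_spec E HE). intros s Hs.
    destruct (cover_sum_halfline E s t Hs) as [s1 [Hc1 Hc2]].
    apply (mu_spec _ H1) in Hc1. apply (mu_spec _ H2) in Hc2. lra.
Qed.

Lemma measurable_interval (x : R) : lebesgue_measurable (fun t => 0 <= t < x).
Proof.
  replace (fun t => 0 <= t < x) with (diff (fun t => t < x) (fun t => t < 0)).
  - apply measurable_diff; apply measurable_halfline.
  - apply set_ext. intro t. unfold diff. lra.
Qed.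

(** * Splitting bounded measurable sets *)

(** Boundedness gives finite outer measure, so [mu] is meaningful on these sets and their
    subsets. *)
Definition mset (m : R) (A : Rset) : Prop :=
  (forall t, A t -> 0 <= t < m) /\ lebesgue_measurable A.

Lemma mset_finite (m : R) (A : Rset) : mset m A -> finite_outer A.
Proof.
  intros [H _]. apply finite_outer_subset with (2 := finite_outer_interval 0 m).
  exact H.
Qed.

Lemma mset_measurable (m : R) (A : Rset) : mset m A -> lebesgue_measurable A.
Proof. intros [_ H]. exact H. Qed.

Lemma mset_cap (m : R) (A B : Rset) :
  mset m A -> lebesgue_measurable B -> mset m (cap A B).
Proof.
  intros [H HA] HB. split; [intros t [Ht _]; auto | apply measurable_cap; auto].
Qed.

Lemma mset_diff (m : R) (A B : Rset) :
  mset m A -> lebesgue_measurable B -> mset m (diff A B).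
Proof.
  intros [H HA] HB. split; [intros t [Ht _]; auto | apply measurable_diff; auto].
Qed.

Lemma mset_cup (m : R) (A B : Rset) : mset m A -> mset m B -> mset m (cup A B).
Proof.
  intros [H HA] [H' HB]. split; [intros t [Ht|Ht]; auto | apply measurable_cup; auto].
Qed.

Lemma mset_interval (m : R) : mset m (fun t => 0 <= t < m).
Proof. split; [auto | apply measurable_interval]. Qed.

Create HintDb mset.
#[local] Hint Resolve mset_finite mset_measurable mset_cap mset_diff mset_cup
  measurable_cap measurable_cup measurable_diff measurable_full : mset.

Lemma mu_mset_le (m : R) (A B : Rset) : mset m B -> subset A B -> mu A <= mu B.
Proof. intros HB H. apply mu_le; eauto with mset. Qed.

Lemma mu_mset_nonneg (m : R) (A : Rset) : mset m A -> 0 <= mu A.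
Proof. intro H. apply mu_nonneg. eauto with mset. Qed.

Lemma mu_mset_split (m : R) (A E : Rset) :
  mset m E -> lebesgue_measurable A -> mu E = mu (cap E A) + mu (diff E A).
Proof. intros HE HA. apply mu_split; eauto with mset. Qed.

Lemma mu_cup_disjoint (m : R) (A B : Rset) :
  mset m A -> mset m B -> disjoint A B -> mu (cup A B) = mu A + mu B.
Proof.
  intros HA HB H. rewrite (mu_mset_split m A (cup A B)) by eauto with mset.
  replace (cap (cup A B) A) with A by set_solve.
  replace (diff (cup A B) A) with B; [reflexivity|].
  apply set_ext. intro t. specialize (H t). set_unfold. tauto.
Qed.

Lemma mu_prefix_lipschitz (m s t : R) (E : Rset) :
  mset m E -> s <= t ->
  mu (cap E (fun x => x < s)) <= mu (cap E (fun x => x < t)) <=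
  mu (cap E (fun x => x < s)) + (t - s).
Proof.
  intros HE Hst. split.
  - apply mu_mset_le with m; [apply mset_cap; auto using measurable_halfline|].
    intros x [Hx Hxs]. split; [exact Hx | lra].
  - assert (Hs : finite_outer (cap E (fun x => x < s))).
    { apply mset_finite with m. apply mset_cap; auto using measurable_halfline. }
    apply Rle_trans with (mu (cap E (fun x => x < s)) + mu (fun x => s <= x < t)).
    + apply Rle_trans with (mu (cup (cap E (fun x => x < s)) (fun x => s <= x < t))).
      * apply mu_le; [|apply finite_outer_cup; auto using finite_outer_interval].
        intros x [Hx Hxt]. destruct (Rlt_dec x s).
        -- left. split; auto.
        -- right. lra.
      * apply mu_cup_le; auto using finite_outer_interval.
    + apply Rplus_le_compat_l.
      apply (mu_spec _ (finite_outer_interval s t)), cover_sum_interval, Hst.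
Qed.

(** The measure of the part of [E] below [t] is 1-Lipschitz in [t], hence continuous, and the
    intermediate value theorem applies. *)
Lemma mu_prefix_surjective (m y : R) (E : Rset) :
  mset m E -> 0 <= y <= mu E -> exists tau, mu (cap E (fun x => x < tau)) = y.
Proof.
  intros HE Hy.
  set (f := fun t => mu (cap E (fun x => x < t)) - y).
  assert (Hf : continuity f).
  { intros t e He. exists e. split; [exact He|]. intros s [_ Hs].
    simpl in *. unfold Rdist, f in *. apply Rabs_def2 in Hs.
    apply Rabs_def1; destruct (Rle_dec s t) as [H|H];
      [ pose proof (mu_prefix_lipschitz m s t E HE H)
      | pose proof (mu_prefix_lipschitz m t s E HE (Rlt_le _ _ (Rnot_le_lt _ _ H)))
      | pose proof (mu_prefix_lipschitz m s t E HE H)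
      | pose proof (mu_prefix_lipschitz m t s E HE (Rlt_le _ _ (Rnot_le_lt _ _ H))) ];
      lra. }
  assert (H0 : f 0 <= 0).
  { unfold f. rewrite mu_empty; [lra|]. intros t [Ht Hlt].
    apply HE in Ht. lra. }
  (* The absolute value keeps the right end nonnegative whatever the sign of [m]; all of [E] lies
     below it. *)
  assert (H1 : 0 <= f (Rabs m)).
  { unfold f. replace (cap E (fun x => x < Rabs m)) with E; [lra|].
    apply set_ext. intro t. split; [|intros [Ht _]; exact Ht].
    intro Ht. split; [exact Ht|]. apply HE in Ht.
    pose proof (Rle_abs m). lra. }
  destruct (IVT_cor f 0 (Rabs m) Hf (Rabs_pos m)) as [z [_ Hz]].
  - nra.
  - exists z. unfold f in Hz. lra.
Qed.

(* [F s], for [s] in [0,1], picks the fraction [s] of [E], and of the trace on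
   [E] of every set in [L]. *)
Definition uniform_family (E : Rset) (L : list Rset) (F : R -> Rset) : Prop :=
  (forall s, lebesgue_measurable (F s)) /\
  (forall s s', 0 <= s -> s <= s' -> s' <= 1 -> subset (F s) (F s')) /\
  (forall t, ~ F 0 t) /\
  (forall t, F 1 t) /\
  (forall s Y, 0 <= s <= 1 -> In Y (full :: L) ->
     mu (cap (cap E (F s)) Y) = s * mu (cap E Y)).

(** [F s] is a half-line that cuts off the fraction [s] of [E]. *)
Lemma uniform_family_nil (m : R) (E : Rset) :
  mset m E -> exists F, uniform_family E nil F.
Proof.
  intro HE.
  pose proof (mu_mset_nonneg m E HE) as Hmu.
  assert (Htau : forall s, exists tau, 0 <= s <= 1 ->
             mu (cap E (fun x => x < tau)) = s * mu E).
  { intro s. destruct (classic (0 <= s <= 1)) as [Hs|Hs].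
    - destruct (mu_prefix_surjective m (s * mu E) E HE) as [tau Ht]; [nra|].
      exists tau. auto.
    - exists 0. tauto. }
  apply choice in Htau. destruct Htau as [tau Htau].
  (* On a null set any threshold fits any [s], so the chosen ones need not be monotone; a constant
     replaces them. *)
  set (tau' := fun s => if Req_dec_T (mu E) 0 then 0 else tau s).
  (* The ends are forced to be everything at [1] and nothing at [0], exactly and not only up to a
     null set. *)
  exists (fun s t => s = 1 \/ (s <> 0 /\ t < tau' s)).
  split; [|split; [|split; [|split]]].
  - intro s. destruct (classic (s = 1)) as [H1|H1].
    { replace (fun t => _) with full; [apply measurable_full|].
      apply set_ext. intro t. set_unfold. tauto. }
    destruct (classic (s = 0)) as [H0|H0].
    { apply measurable_empty. tauto. }
    replace (fun t => _) with (fun t => t < tau' s); [apply measurable_halfline|].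
    apply set_ext. intro t. tauto.
  - intros s s' H0 Hs H1 t [Ht|[Hn Ht]]; [left; lra|].
    destruct (classic (s' = 1)); [left; auto|]. right. split; [lra|].
    apply Rlt_le_trans with (1 := Ht).
    unfold tau'. destruct (Req_dec_T (mu E) 0) as [|Hne]; [lra|].
    destruct Hs as [Hs| ->]; [|lra].
    (* Thresholds in the wrong order would give [s' * mu E <= s * mu E] with [s < s'] and [mu E]
       positive. *)
    apply Rnot_lt_le. intro Hlt.
    destruct (mu_prefix_lipschitz m (tau s') (tau s) E HE) as [Hle _]; [lra|].
    rewrite !Htau in Hle by lra. nra.
  - intros t [H|[H _]]; lra.
  - intros t. left. reflexivity.
  - intros s Y Hs [<-|[]].
    replace (cap E full) with E by set_solve.
    destruct (classic (mu E = 0)) as [Hz|Hz].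
    { rewrite Hz, Rmult_0_r. apply Rle_antisym.
      - rewrite <- Hz. apply mu_mset_le with m; [exact HE | intros t [[Ht _] _]; exact Ht].
      - destruct (classic (mu (cap (cap E (fun t => s = 1 \/ s <> 0 /\ t < tau' s)) full) < 0))
          as [Hlt|Hlt]; [|lra].
        exfalso. enough (0 <= mu (cap (cap E (fun t => s = 1 \/ s <> 0 /\ t < tau' s)) full))
          by lra.
        apply mu_nonneg, finite_outer_subset with E; [intros t [[Ht _] _]; exact Ht|].
        apply mset_finite with m, HE. }
    assert (Ht : tau' s = tau s) by (unfold tau'; destruct (Req_dec_T (mu E) 0); tauto).
    destruct (classic (s = 1)) as [H1|H1].
    { subst s. rewrite Rmult_1_l. f_equal. apply set_ext.
      intro t. set_unfold. tauto. }
    destruct (classic (s = 0)) as [H0|H0].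
    { subst s. rewrite Rmult_0_l. apply mu_empty.
      intro t. set_unfold. tauto. }
    rewrite <- Htau by exact Hs. f_equal. apply set_ext.
    intro t. rewrite <- Ht. set_unfold. tauto.
Qed.

(** By induction on [L]: cut [E] along [Y0], take families uniform for the remaining sets on both
    pieces, and glue them along [Y0]. Traces of the remaining sets add up over the pieces, and the
    trace of [Y0] is the whole of one piece. *)
Lemma uniform_family_exists (L : list Rset) :
  (forall Y, In Y L -> lebesgue_measurable Y) ->
  forall m E, mset m E -> exists F, uniform_family E L F.
Proof.
  induction L as [|Y0 L IH]; intros HL m E HE; [apply uniform_family_nil with m, HE|].
  assert (HY0 : lebesgue_measurable Y0) by (apply HL; left; reflexivity).
  assert (HL' : forall Y, In Y L -> lebesgue_measurable Y) by (intros; apply HL; right; auto).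
  destruct (IH HL' m (cap E Y0)) as [F1 [M1 [N1 [Z1 [O1 U1]]]]]; [auto with mset|].
  destruct (IH HL' m (diff E Y0)) as [F2 [M2 [N2 [Z2 [O2 U2]]]]]; [auto with mset|].
  set (F := fun s => cup (cap Y0 (F1 s)) (diff (F2 s) Y0)).
  assert (HF : forall s, lebesgue_measurable (F s)) by (intro s; unfold F; auto with mset).
  exists F. split; [exact HF|]. split; [|split; [|split]].
  - intros s s' H0 Hs H1 t. specialize (N1 s s' H0 Hs H1 t).
    specialize (N2 s s' H0 Hs H1 t). unfold F. set_unfold. tauto.
  - intro t. specialize (Z1 t). specialize (Z2 t). unfold F. set_unfold. tauto.
  - intro t. specialize (O1 t). specialize (O2 t). unfold F. set_unfold.
    destruct (classic (Y0 t)); tauto.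
  - intros s Y Hs HY.
    assert (HmY : lebesgue_measurable Y).
    { destruct HY as [<-|HY]; [apply measurable_full | apply HL, HY]. }
    rewrite (mu_mset_split m Y0 (cap (cap E (F s)) Y)) by auto with mset.
    rewrite (mu_mset_split m Y0 (cap E Y)) by auto with mset.
    rewrite Rmult_plus_distr_l.
    assert (HY' : Y = Y0 \/ In Y (full :: L)) by (simpl in *; intuition).
    destruct HY' as [->|HY'].
    + rewrite (mu_empty (diff (cap (cap E (F s)) Y0) Y0)) by (intro t; set_unfold; tauto).
      rewrite (mu_empty (diff (cap E Y0) Y0)) by (intro t; set_unfold; tauto).
      rewrite Rmult_0_r. f_equal.
      replace (cap (cap E Y0) Y0) with (cap (cap E Y0) full) by set_solve.
      rewrite <- (U1 s full Hs) by (left; reflexivity).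
      f_equal. unfold F. set_solve.
    + replace (cap (cap E Y) Y0) with (cap (cap E Y0) Y) by set_solve.
      replace (diff (cap E Y) Y0) with (cap (diff E Y0) Y) by set_solve.
      rewrite <- (U1 s Y Hs HY'), <- (U2 s Y Hs HY').
      f_equal; f_equal; unfold F; set_solve.
Qed.

Lemma subset_of_measure (m y : R) (E : Rset) :
  mset m E -> 0 <= y <= mu E -> exists A, mset m A /\ subset A E /\ mu A = y.
Proof.
  intros HE Hy. destruct (mu_prefix_surjective m y E HE Hy) as [tau Ht].
  exists (cap E (fun x => x < tau)). split; [|split; [set_solve|exact Ht]].
  apply mset_cap; auto using measurable_halfline.
Qed.

(** * Maps that pull sets back to independent sets *)

Definition preimage (D : Rset) (phi : R -> R) (Q : Rset) : Rset :=
  fun t => D t /\ Q (phi t).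

(* [phi] carries [D] to [E] so that the sets in [LM], pulled back, are
   independent of the sets in [LT]. *)
Definition transport (D E : Rset) (LM LT : list Rset) (phi : R -> R) : Prop :=
  forall Q, In Q LM ->
    lebesgue_measurable (preimage D phi Q) /\
    forall Y, In Y (full :: LT) ->
      mu (cap (preimage D phi Q) Y) * mu E = mu (cap D Y) * mu (cap E Q).

(** By induction on [LM]: if [Q0] takes the fraction [r] of [E], a part [R1] holding the fraction
    [r] of [D], uniformly for [LT], is sent into [Q0] and the rest of [D] outside it. The pullback
    of [Q0] is then [cap D R1], and the recursive maps on the two parts handle the other sets. *)
Lemma transport_exists (mT mM : R) (LT : list Rset) :
  (forall Y, In Y LT -> lebesgue_measurable Y) ->
  forall LM, (forall Q, In Q LM -> lebesgue_measurable Q) ->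
  forall D E, mset mT D -> mset mM E -> (exists x, E x) ->
  exists phi, (forall t, E (phi t)) /\ transport D E LM LT phi.
Proof.
  intros HLT LM. induction LM as [|Q0 LM IH]; intros HLM D E HD HE [x Hx].
  { exists (fun _ => x). split; [auto | intros Q []]. }
  assert (HQ0 : lebesgue_measurable Q0) by (apply HLM; left; reflexivity).
  specialize (IH (fun Q HQ => HLM Q (or_intror HQ))).
  assert (HLT' : forall Y, In Y (full :: LT) -> lebesgue_measurable Y).
  { intros Y [<-|HY]; auto with mset. }
  (* A recursive map needs a nonempty target. If [Q0] misses [E] or contains it, the pullback of
     [Q0] is empty or all of [D] for any map into [E]. *)
  destruct (classic (exists x, E x /\ Q0 x)) as [[x1 Hx1]|Hno1].
  2:{ destruct (IH D E HD HE (ex_intro _ x Hx)) as [phi [Hphi Htr]].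
      exists phi. split; [exact Hphi|]. intros Q [<-|HQ]; [|apply Htr, HQ].
      assert (Hem : forall t, ~ preimage D phi Q0 t).
      { intros t [_ Ht]. apply Hno1. exists (phi t). auto. }
      split; [apply measurable_empty, Hem|]. intros Y HY.
      rewrite (mu_empty (cap (preimage D phi Q0) Y)) by (intros t [Ht _]; exact (Hem t Ht)).
      rewrite (mu_empty (cap E Q0)) by (intros t Ht; apply Hno1; eauto). ring. }
  destruct (classic (exists x, E x /\ ~ Q0 x)) as [[x2 Hx2]|Hno2].
  2:{ destruct (IH D E HD HE (ex_intro _ x Hx)) as [phi [Hphi Htr]].
      exists phi. split; [exact Hphi|]. intros Q [<-|HQ]; [|apply Htr, HQ].
      assert (HEQ : forall t, E t -> Q0 t).
      { intros t Ht. apply NNPP. intro. apply Hno2. eauto. }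
      assert (Heq : preimage D phi Q0 = D).
      { apply set_ext. intro t. split; [intros [Ht _]; exact Ht|].
        intro Ht. split; auto. }
      rewrite Heq. split; [eauto with mset|]. intros Y HY.
      do 2 f_equal. apply set_ext. intro t. specialize (HEQ t). set_unfold. tauto. }
  pose proof (mu_mset_nonneg mM E HE) as HE0.
  assert (HE1 : mset mM (cap E Q0)) by auto with mset.
  assert (HE2 : mset mM (diff E Q0)) by auto with mset.
  pose proof (mu_mset_nonneg mM _ HE1) as He1.
  pose proof (mu_mset_nonneg mM _ HE2) as He2.
  pose proof (mu_mset_split mM Q0 E HE HQ0) as Hsum.
  set (e := mu E) in *. set (e1 := mu (cap E Q0)) in *. set (e2 := mu (diff E Q0)) in *.
  (* For a null set [E] any ratio would do; [0] is taken. *)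
  assert (Hr : exists r, 0 <= r <= 1 /\ r * e = e1).
  { destruct (Req_dec e 0) as [Hz|Hz].
    - exists 0. lra.
    - exists (e1 / e). split; [|field; exact Hz].
      split; [apply Rle_mult_inv_pos; lra | apply Rle_div_l; lra]. }
  destruct Hr as [r [Hr Hre]].
  destruct (uniform_family_exists LT HLT mT D HD) as [F [MF [_ [_ [_ UF]]]]].
  specialize (MF r).
  assert (UF' : forall Y, In Y (full :: LT) -> mu (cap (cap D (F r)) Y) = r * mu (cap D Y))
    by auto.
  clear UF. set (R1 := F r) in *. clearbody R1. clear F.
  assert (HD1 : mset mT (cap D R1)) by auto with mset.
  assert (HD2 : mset mT (diff D R1)) by auto with mset.
  destruct (IH _ _ HD1 HE1 (ex_intro _ x1 Hx1)) as [phi1 [Hphi1 Htr1]].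
  destruct (IH _ _ HD2 HE2 (ex_intro _ x2 Hx2)) as [phi2 [Hphi2 Htr2]].
  set (phi := fun t => if excluded_middle_informative (R1 t) then phi1 t else phi2 t).
  assert (Hp1 : forall t, R1 t -> phi t = phi1 t)
    by (intros t Ht; unfold phi; destruct excluded_middle_informative; tauto).
  assert (Hp2 : forall t, ~ R1 t -> phi t = phi2 t)
    by (intros t Ht; unfold phi; destruct excluded_middle_informative; tauto).
  assert (Hin : forall Y, In Y (full :: LT) ->
            mu (cap (diff D R1) Y) = (1 - r) * mu (cap D Y)).
  { intros Y HY. specialize (HLT' Y HY). specialize (UF' Y HY).
    rewrite (mu_mset_split mT R1 (cap D Y)) in * by auto with mset.
    replace (cap (diff D R1) Y) with (diff (cap D Y) R1) by set_solve.
    replace (cap (cap D R1) Y) with (cap (cap D Y) R1) in UF' by set_solve. lra. }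
  exists phi. split.
  { intro t. destruct (classic (R1 t)) as [Ht|Ht].
    - rewrite Hp1 by exact Ht. apply Hphi1.
    - rewrite Hp2 by exact Ht. apply Hphi2. }
  intros Q [<-|HQ].
  - assert (Heq : preimage D phi Q0 = cap D R1).
    { apply set_ext. intro t. unfold preimage. split.
      - intros [Ht Hq]. split; [exact Ht|]. apply NNPP. intro Hn.
        rewrite Hp2 in Hq by exact Hn. apply (Hphi2 t), Hq.
      - intros [Ht H1]. split; [exact Ht|]. rewrite Hp1 by exact H1. apply Hphi1. }
    rewrite Heq. split; [eauto with mset|]. intros Y HY. rewrite (UF' Y HY).
    fold e e1. rewrite <- Hre. ring.
  - destruct (Htr1 Q HQ) as [Mq1 Tr1]. destruct (Htr2 Q HQ) as [Mq2 Tr2].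
    assert (HmQ : lebesgue_measurable Q) by (apply HLM; right; exact HQ).
    assert (Heq : preimage D phi Q =
              cup (preimage (cap D R1) phi1 Q) (preimage (diff D R1) phi2 Q)).
    { apply set_ext. intro t. unfold preimage. set_unfold.
      destruct (classic (R1 t)) as [Ht|Ht].
      - rewrite Hp1 by exact Ht. tauto.
      - rewrite Hp2 by exact Ht. tauto. }
    split; [rewrite Heq; auto with mset|].
    intros Y HY. specialize (HLT' Y HY).
    assert (HP1 : mset mT (preimage (cap D R1) phi1 Q)).
    { split; [intros t [[Ht _] _]; apply HD, Ht | exact Mq1]. }
    assert (HP2 : mset mT (preimage (diff D R1) phi2 Q)).
    { split; [intros t [[Ht _] _]; apply HD, Ht | exact Mq2]. }
    replace (cap (preimage D phi Q) Y) with
      (cup (cap (preimage (cap D R1) phi1 Q) Y) (cap (preimage (diff D R1) phi2 Q) Y))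
      by (rewrite Heq; set_solve).
    rewrite (mu_cup_disjoint mT); [| auto with mset | auto with mset |
      intro t; unfold preimage; set_unfold; tauto].
    rewrite (mu_mset_split mM Q0 (cap E Q)) by auto with mset.
    specialize (Tr1 Y HY). specialize (Tr2 Y HY).
    rewrite (UF' Y HY) in Tr1. rewrite (Hin Y HY) in Tr2.
    fold e1 in Tr1. fold e2 in Tr2. fold e.
    replace (cap (cap E Q0) Q) with (cap (cap E Q) Q0) in Tr1 by set_solve.
    replace (cap (diff E Q0) Q) with (diff (cap E Q) Q0) in Tr2 by set_solve.
    assert (Hle1 : mu (cap (preimage (cap D R1) phi1 Q) Y) <= r * mu (cap D Y)).
    { rewrite <- (UF' Y HY). apply mu_mset_le with mT; [auto with mset|].
      intro t; unfold preimage; set_unfold; tauto. }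
    assert (Hle2 : mu (cap (preimage (diff D R1) phi2 Q) Y) <= (1 - r) * mu (cap D Y)).
    { rewrite <- (Hin Y HY). apply mu_mset_le with mT; [auto with mset|].
      intro t; unfold preimage; set_unfold; tauto. }
    assert (Hq1 : mu (cap (cap E Q) Q0) <= e1).
    { apply mu_mset_le with mM; [exact HE1 | set_solve]. }
    assert (Hq2 : mu (diff (cap E Q) Q0) <= e2).
    { apply mu_mset_le with mM; [exact HE2 | set_solve]. }
    assert (Hx1' : 0 <= mu (cap (preimage (cap D R1) phi1 Q) Y))
      by (apply mu_mset_nonneg with mT; auto with mset).
    assert (Hx2' : 0 <= mu (cap (preimage (diff D R1) phi2 Q) Y))
      by (apply mu_mset_nonneg with mT; auto with mset).
    assert (Hq1' : 0 <= mu (cap (cap E Q) Q0))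
      by (apply mu_mset_nonneg with mM; auto with mset).
    assert (Hq2' : 0 <= mu (diff (cap E Q) Q0))
      by (apply mu_mset_nonneg with mM; auto with mset).
    assert (Hy : 0 <= mu (cap D Y)) by (apply mu_mset_nonneg with mT; auto with mset).
    set (a1 := mu (cap (preimage (cap D R1) phi1 Q) Y)) in *.
    set (a2 := mu (cap (preimage (diff D R1) phi2 Q) Y)) in *.
    set (q1 := mu (cap (cap E Q) Q0)) in *. set (q2 := mu (diff (cap E Q) Q0)) in *.
    set (y := mu (cap D Y)) in *. clearbody a1 a2 q1 q2 y e e1 e2.
    (* Rescales the product rule from a piece to all of [E] by cancelling [r']; if [r' = 0], the
       bounds force [a] and [q] to vanish. *)
    assert (Hs : forall a q e' r', 0 <= a -> 0 <= q -> q <= e' -> a <= r' * y ->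
              r' * e = e' -> a * e' = r' * y * q -> a * e = y * q).
    { clear. intros a q e' r' Ha Hq Hqe Har Hre H.
      destruct (Req_dec r' 0) as [->|Hr0].
      - assert (a = 0) by lra. assert (q = 0) by lra. subst. ring.
      - apply Rmult_eq_reg_l with r'; [|exact Hr0]. rewrite <- Hre in H. lra. }
    rewrite Rmult_plus_distr_r, Rmult_plus_distr_l.
    rewrite (Hs a1 q1 e1 r), (Hs a2 q2 e2 (1 - r)); auto; lra.
Qed.

(** * Colour sets around a precoloured vertex *)

Lemma unit_subset_iff (m : R) (A : Rset) : unit_subset m A <-> mset m A /\ mu A = 1.
Proof.
  unfold unit_subset, mset. rewrite lebesgue_outer_mu. split.
  - intros [H1 [H2 [H3 H4]]]. auto.
  - intros [[H1 H2] H3]. repeat split; auto; try apply H1; auto.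
    apply mset_finite with m. split; auto.
Qed.

(** The geometric sum of [eps * q ^ (2 * j)] over [j < i]. With [q = k - 1] it is the density
    released at even distances after [i] rounds, as long as colours outside [X] last. *)
Fixpoint slack (q eps : R) (i : nat) : R :=
  match i with O => 0 | S i' => eps + q * q * slack q eps i' end.

Lemma slack_succ (q eps : R) (i : nat) :
  slack q eps (S i) = slack q eps i + eps * q ^ (2 * i).
Proof.
  induction i as [|i IH]; [simpl; ring|].
  change (slack q eps (S (S i))) with (eps + q * q * slack q eps (S i)).
  rewrite IH at 1. change (slack q eps (S i)) with (eps + q * q * slack q eps i).
  replace (2 * S i)%nat with (S (S (2 * i))) by lia. simpl. ring.
Qed.

(** Identifies the sum in the theorem as the density that the slack lets vertices at odd distance
    release. *)
Lemma slack_sum (q eps : R) (n : nat) :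
  eps * sum_f_R0 (fun j => q ^ (2 * j + 1)) n = q * slack q eps (S n).
Proof.
  induction n as [|n IH]; [simpl; ring|].
  rewrite tech5, Rmult_plus_distr_l, IH, (slack_succ q eps (S n)).
  rewrite pow_add. ring.
Qed.

Lemma slack_mono (q eps : R) (i : nat) :
  0 <= q -> 0 <= eps -> 0 <= slack q eps i <= slack q eps (S i).
Proof.
  intros Hq He. rewrite slack_succ.
  assert (0 <= eps * q ^ (2 * i)) by (apply Rmult_le_pos; [lra | apply pow_le; lra]).
  enough (0 <= slack q eps i) by lra. clear H.
  induction i as [|i IH]; simpl; [lra|].
  assert (0 <= q * q * slack q eps i) by (apply Rmult_le_pos; [nra | lra]). lra.
Qed.

(* The colour sets offered around a precoloured vertex with colour set [X]:
   [Q j] serves the vertices at distance [2 n + 1 - j] from it.  Moving inwards,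
   odd distances gradually trade the part of [F v] inside [X] (sets [V i]) for
   common colours outside [X] (sets [U i]), and even distances do the opposite,
   using the spare colours [S]; a colour released by the vertices of one kind
   with density [x] on [D] gains [(k - 1) * x] for those of the other kind. *)
Lemma palette_exists (m k p eps : R) (T : Type) (l : list T) (e : T -> T -> Prop)
    (F : T -> Rset) (D S X : Rset) (n : nat) :
  (forall v, In v l) ->
  (forall u v, e u v -> disjoint (F u) (F v)) ->
  mset m D -> mset m S -> mset m X -> disjoint S D ->
  mu D = k -> mu S = eps -> mu (cap D X) = p * k ->
  (forall v, mset m (F v) /\ subset (F v) D /\ mu (F v) = 1 /\ mu (cap (F v) X) = p) ->
  0 < p < 1 -> 1 <= k -> p <= (k - 1) * (1 - p) -> 1 - p <= eps + (k - 1) * p ->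
  p <= (k - 1) * slack (k - 1) eps n ->
  exists Q : nat -> T -> Rset,
    (forall j v, mset m (Q j v) /\ 1 <= mu (Q j v)) /\
    (forall v, Q 0%nat v = F v) /\
    (forall j u v, e u v -> disjoint (Q j u) (Q (Datatypes.S j) v)) /\
    (forall v, disjoint (Q (2 * n)%nat v) X).
Proof.
  intros Hl He HD HS HX HSD HmuD HmuS HDX HF Hp Hk Hpq Hpe Hn.
  set (q := k - 1) in *.
  assert (Heps : 0 <= eps) by (rewrite <- HmuS; apply mu_mset_nonneg with m, HS).
  assert (HmX : lebesgue_measurable X) by eauto with mset.
  assert (HL : forall Y, In Y (map F l) -> lebesgue_measurable Y).
  { intros Y HY. apply in_map_iff in HY. destruct HY as [v [<- _]].
    apply mset_measurable with m, HF. }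
  assert (HFl : forall v, In (F v) (full :: map F l)).
  { intro v. right. apply in_map, Hl. }
  destruct (uniform_family_exists _ HL m (diff D X)) as [FU [MU [NU [ZU [OU UU]]]]];
    [auto with mset|].
  destruct (uniform_family_exists _ HL m (cap D X)) as [FV [MV [NV [ZV [OV UV]]]]];
    [auto with mset|].
  (* The caps [1 - p] and [p] are the measures of [F v] outside and inside [X]: no more can be
     released. *)
  set (u := fun i => Rmin (1 - p) (slack q eps i)).
  set (v := fun i => Rmin p (q * slack q eps i)).
  assert (Hq : 0 <= q) by (unfold q; lra).
  assert (Hu : forall i, 0 <= u i <= 1 - p /\ u i <= u (Datatypes.S i)).
  { intro i. destruct (slack_mono q eps i Hq Heps).
    unfold u, Rmin. destruct (Rle_dec (1 - p) (slack q eps i)),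
      (Rle_dec (1 - p) (slack q eps (Datatypes.S i))); lra. }
  assert (Hv : forall i, 0 <= v i <= p /\ v i <= v (Datatypes.S i)).
  { intro i. destruct (slack_mono q eps i Hq Heps).
    assert (0 <= q * slack q eps i) by (apply Rmult_le_pos; lra).
    assert (q * slack q eps i <= q * slack q eps (Datatypes.S i))
      by (apply Rmult_le_compat_l; lra).
    unfold v, Rmin. destruct (Rle_dec p (q * slack q eps i)),
      (Rle_dec p (q * slack q eps (Datatypes.S i))); lra. }
  (* The loss [v i] is repaid by the gain from [U i]; if [u i] is at its cap, this is
     [p <= (k - 1) * (1 - p)]. *)
  assert (Hvu : forall i, v i <= q * u i).
  { intro i. unfold u. pose proof (Rmin_l p (q * slack q eps i)).
    pose proof (Rmin_r p (q * slack q eps i)). fold (v i) in *.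
    pattern (Rmin (1 - p) (slack q eps i)). apply Rmin_case; lra. }
  (* This is the recursion of [slack], or [1 - p <= eps + (k - 1) * p] if [v i] is at its cap. *)
  assert (Huv : forall i, u (Datatypes.S i) <= eps + q * v i).
  { intro i. unfold v. pose proof (Rmin_l (1 - p) (slack q eps (Datatypes.S i))).
    pose proof (Rmin_r (1 - p) (slack q eps (Datatypes.S i))) as Hr.
    fold (u (Datatypes.S i)) in *. simpl slack in Hr.
    pattern (Rmin p (q * slack q eps i)). apply Rmin_case; lra. }
  (* Dividing by [1 - p], and by [p] in [V], turns densities relative to [D] into fractions of
     [diff D X] and [cap D X]. *)
  set (U := fun i => cap (diff D X) (FU (u i / (1 - p)))).
  set (V := fun i => cap (cap D X) (FV (v i / p))).
  assert (Hus : forall i, 0 <= u i / (1 - p) <= 1).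
  { intro i. destruct (Hu i). split; [apply Rle_mult_inv_pos; lra | apply Rle_div_l; lra]. }
  assert (Hvs : forall i, 0 <= v i / p <= 1).
  { intro i. destruct (Hv i). split; [apply Rle_mult_inv_pos; lra | apply Rle_div_l; lra]. }
  assert (HU : forall i, mset m (U i)) by (intro i; unfold U; auto with mset).
  assert (HV : forall i, mset m (V i)) by (intro i; unfold V; auto with mset).
  (* Neighbouring palettes may use consecutive indices; what one side takes must already be released
     by the other. *)
  assert (HUs : forall i, subset (U i) (U (Datatypes.S i))).
  { intros i t [Ht Hf]. split; [exact Ht|]. revert Hf. apply NU; try apply Hus.
    apply Rmult_le_compat_r; [left; apply Rinv_0_lt_compat; lra | apply Hu]. }
  assert (HVs : forall i, subset (V i) (V (Datatypes.S i))).
  { intros i t [Ht Hf]. split; [exact Ht|]. revert Hf. apply NV; try apply Hvs.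
    apply Rmult_le_compat_r; [left; apply Rinv_0_lt_compat; lra | apply Hv]. }
  assert (HmuU : forall i, mu (U i) = u i * k).
  { intro i. replace (U i) with (cap (U i) full) by set_solve.
    unfold U. rewrite UU; [| apply Hus | left; reflexivity].
    replace (cap (diff D X) full) with (diff D X) by set_solve.
    pose proof (mu_mset_split m X D HD HmX) as Hsp.
    replace (mu (diff D X)) with ((1 - p) * k) by lra. field. lra. }
  assert (HmuV : forall i, mu (V i) = v i * k).
  { intro i. replace (V i) with (cap (V i) full) by set_solve.
    unfold V. rewrite UV; [| apply Hvs | left; reflexivity].
    replace (cap (cap D X) full) with (cap D X) by set_solve.
    rewrite HDX. field. lra. }
  assert (HmuUF : forall i w, mu (cap (U i) (F w)) = u i).
  { intros i w. unfold U. rewrite UU; [| apply Hus | apply HFl].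
    destruct (HF w) as [Hm [Hs [H1 Hp1]]].
    replace (cap (diff D X) (F w)) with (diff (F w) X)
      by (apply set_ext; intro t; specialize (Hs t); set_unfold; tauto).
    pose proof (mu_mset_split m X (F w) Hm HmX) as Hsp.
    replace (mu (diff (F w) X)) with (1 - p) by lra. field. lra. }
  assert (HmuVF : forall i w, mu (cap (V i) (F w)) = v i).
  { intros i w. unfold V. rewrite UV; [| apply Hvs | apply HFl].
    destruct (HF w) as [Hm [Hs [H1 Hp1]]].
    replace (cap (cap D X) (F w)) with (cap (F w) X)
      by (apply set_ext; intro t; specialize (Hs t); set_unfold; tauto).
    rewrite Hp1. field. lra. }
  assert (HUX : forall i t, U i t -> D t /\ ~ X t)
    by (intros i t [Ht _]; exact Ht).
  assert (HVX : forall i t, V i t -> D t /\ X t)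
    by (intros i t [Ht _]; exact Ht).
  assert (HFD : forall w t, F w t -> D t)
    by (intros w t Ht; apply (HF w); exact Ht).
  assert (HSD' : forall t, S t -> ~ D t) by (intros t H1 H2; apply (HSD t); auto).
  assert (U0 : forall t, ~ U 0%nat t).
  { intros t [_ Ht]. apply (ZU t). replace 0 with (u 0%nat / (1 - p)); [exact Ht|].
    unfold u. simpl. rewrite Rmin_right by lra. field. lra. }
  assert (V0 : forall t, ~ V 0%nat t).
  { intros t [_ Ht]. apply (ZV t). replace 0 with (v 0%nat / p); [exact Ht|].
    unfold v. simpl. rewrite Rmult_0_r, Rmin_right by lra. field. lra. }
  (* By the bound on [slack] at [n], [v n] has reached its cap [p], so the last palette has released
     all of [X]. *)
  assert (Vn : forall t, D t -> X t -> V n t).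
  { intros t HDt HXt. split; [split; auto|].
    replace (v n / p) with 1; [apply OV|].
    unfold v. rewrite Rmin_left by lra. field. lra. }
  clearbody U V. clear FU FV MU NU ZU OU UU MV NV ZV OV UV.
  (* [Qe] fills the even places of the list, which serve odd distances. [Qo] is one release ahead,
     with index [i + 1] in [U], since it also draws on [S]. *)
  set (Qe := fun i w => cup (diff (F w) (V i)) (U i)).
  set (Qo := fun i w => cup (diff (F w) (U (Datatypes.S i))) (cup S (V i))).
  exists (interleave Qe Qo).
  assert (Hpar : forall j, exists i, j = (2 * i)%nat \/ j = Datatypes.S (2 * i)).
  { intro j. destruct (Nat.Even_or_Odd j) as [[i Hi]|[i Hi]]; exists i; lia. }
  split; [|split; [|split]].
  - intros j w. destruct (HF w) as [Hm [_ [H1 _]]].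
    destruct (Hpar j) as [i [-> | ->]].
    + rewrite interleave_even. unfold Qe.
      split; [eauto 6 with mset|].
      (* As a disjoint union, the palette has measure [1 - v i + (k - 1) * u i]. *)
      replace (cup (diff (F w) (V i)) (U i))
        with (cup (diff (F w) (V i)) (diff (U i) (F w)))
        by (apply set_ext; intro t; specialize (HUX i t); specialize (HVX i t);
            set_unfold; tauto).
      rewrite (mu_cup_disjoint m); [| eauto with mset | eauto with mset |
        intro t; set_unfold; tauto].
      pose proof (mu_mset_split m (V i) (F w) Hm (mset_measurable _ _ (HV i))) as E1.
      pose proof (mu_mset_split m (F w) (U i) (HU i) (mset_measurable _ _ Hm)) as E2.
      replace (cap (F w) (V i)) with (cap (V i) (F w)) in E1 by set_solve.
      rewrite HmuVF, H1 in E1. rewrite HmuUF, HmuU in E2.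
      specialize (Hvu i). unfold q in Hvu. lra.
    + rewrite interleave_odd. unfold Qo.
      split; [eauto 6 with mset|].
      (* Here the measure is [1 - u (i + 1) + eps + (k - 1) * v i]. *)
      replace (cup (diff (F w) (U (Datatypes.S i))) (cup S (V i)))
        with (cup (diff (F w) (U (Datatypes.S i))) (cup S (diff (V i) (F w))))
        by (apply set_ext; intro t; specialize (HUX (Datatypes.S i) t);
            specialize (HVX i t); set_unfold; tauto).
      rewrite (mu_cup_disjoint m); [| eauto with mset | eauto with mset |
        intro t; specialize (HFD w t); specialize (HSD' t); set_unfold; tauto].
      rewrite (mu_cup_disjoint m); [| eauto with mset | eauto with mset |
        intro t; specialize (HVX i t); specialize (HSD' t); set_unfold; tauto].
      pose proof (mu_mset_split m (U (Datatypes.S i)) (F w) Hm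
                    (mset_measurable _ _ (HU _))) as E1.
      pose proof (mu_mset_split m (F w) (V i) (HV i) (mset_measurable _ _ Hm)) as E2.
      replace (cap (F w) (U (Datatypes.S i)))
        with (cap (U (Datatypes.S i)) (F w)) in E1 by set_solve.
      rewrite HmuUF, H1 in E1. rewrite HmuVF, HmuV in E2.
      specialize (Huv i). unfold q in Huv. lra.
  - intro w. change (interleave Qe Qo 0) with (Qe 0%nat). unfold Qe. apply set_ext.
    intro t. specialize (U0 t). specialize (V0 t). set_unfold. tauto.
  - intros j a b Hab t. specialize (He a b Hab t).
    destruct (Hpar j) as [i [-> | ->]].
    + rewrite interleave_even, interleave_odd. unfold Qe, Qo.
      pose proof (HUX i t). pose proof (HVX i t). pose proof (HUs i t).
      pose proof (HSD' t). pose proof (HFD a t). set_unfold. tauto.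
    + replace (Datatypes.S (Datatypes.S (2 * i))) with (2 * Datatypes.S i)%nat by lia.
      rewrite interleave_even, interleave_odd. unfold Qe, Qo.
      pose proof (HUX (Datatypes.S i) t). pose proof (HVX i t). pose proof (HVs i t).
      pose proof (HSD' t). pose proof (HFD b t). set_unfold. tauto.
  - intros w t. rewrite interleave_even. unfold Qe.
    pose proof (HUX n t). pose proof (Vn t). pose proof (HFD w t). set_unfold. tauto.
Qed.

(** * Short odd walks *)

Lemma walk_trans (G : graph) (u v w : vtx G) (n m : nat) :
  walk G u v n -> walk G v w m -> walk G u w (n + m).
Proof.
  intros H1 H2. induction H1 as [u|u x v n Hux _ IH]; [exact H2|].
  simpl. apply walkS with x; auto.
Qed.

Lemma walk_step (G : graph) (u v : vtx G) : adj G u v -> walk G u v 1.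
Proof. intro H. apply walkS with v; [exact H | apply walk0]. Qed.

Lemma walk_sym (G : graph) (u v : vtx G) (n : nat) : walk G u v n -> walk G v u n.
Proof.
  intro H. induction H as [u|u x v n Hux _ IH]; [apply walk0|].
  replace (S n) with (n + 1)%nat by lia.
  apply walk_trans with x; [exact IH | apply walk_step, adj_sym, Hux].
Qed.

Lemma walk_zero (G : graph) (u v : vtx G) : walk G u v 0 -> u = v.
Proof. intro H. inversion H. reflexivity. Qed.

(* Each step of a walk loses at most the [k - 2] colours outside two adjacent
   vertices. *)
Lemma coloring_along_walk (G : graph) (k : R) (c : vtx G -> Rset) (u v : vtx G) (n : nat) :
  fractional_coloring G k c -> 0 <= k -> walk G u v n ->
  forall i,
    (n = (2 * i)%nat -> 1 - INR i * (k - 2) <= mu (cap (c v) (c u))) /\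
    (n = S (2 * i) -> mu (cap (c v) (c u)) <= INR i * (k - 2)).
Proof.
  intros [Hc Hd] Hk H.
  assert (Hu : forall v, mset k (c v) /\ mu (c v) = 1)
    by (intro; apply unit_subset_iff, Hc).
  induction H as [u|u x v n Hux _ IH]; intro i.
  - split; [|lia]. intro H0. replace i with 0%nat by lia.
    replace (cap (c u) (c u)) with (c u) by set_solve.
    simpl. destruct (Hu u). lra.
  - destruct (Hu u) as [Mu Eu]. destruct (Hu v) as [Mv Ev]. destruct (Hu x) as [Mx Ex].
    specialize (Hd u x Hux).
    pose proof (mu_mset_split k (c x) (c v) Mv (mset_measurable _ _ Mx)) as E1.
    rewrite Ev in E1.
    split; intro Hn.
    + destruct i as [|i]; [lia|]. destruct (IH i) as [_ IH2].
      specialize (IH2 ltac:(lia)).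
      (* The part of [c v] outside [c x] meets [c u] except in the colours outside both [c u] and
         [c x], of measure [k - 2]. *)
      assert (Mvx : mset k (diff (c v) (c x))) by eauto with mset.
      pose proof (mu_mset_split k (c u) _ Mvx (mset_measurable _ _ Mu)) as E2.
      replace (cap (diff (c v) (c x)) (c u)) with (cap (c v) (c u)) in E2
        by (apply set_ext; intro t; specialize (Hd t); set_unfold; tauto).
      pose proof (mu_mset_split k (cup (c u) (c x)) _ (mset_interval k)
                    (mset_measurable k _ (mset_cup _ _ _ Mu Mx))) as E3.
      rewrite (mu_interval k Hk) in E3.
      replace (cap (fun t => 0 <= t < k) (cup (c u) (c x))) with (cup (c u) (c x)) in E3.
      2:{ apply set_ext. intro t. destruct Mu as [Iu _], Mx as [Ix _].
          specialize (Iu t). specialize (Ix t). set_unfold. tauto. }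
      rewrite (mu_cup_disjoint k _ _ Mu Mx Hd) in E3.
      assert (mu (diff (diff (c v) (c x)) (c u)) <=
              mu (diff (fun t => 0 <= t < k) (cup (c u) (c x)))).
      { apply mu_mset_le with k.
        - apply mset_diff; [apply mset_interval | eauto with mset].
        - intro t. destruct Mv as [Iv _]. specialize (Iv t). set_unfold. tauto. }
      rewrite S_INR. lra.
    + destruct (IH i) as [IH1 _]. specialize (IH1 ltac:(lia)).
      assert (mu (cap (c v) (c u)) <= mu (diff (c v) (c x))).
      { apply mu_mset_le with k; [eauto with mset|].
        intro t. specialize (Hd t). set_unfold. tauto. }
      lra.
Qed.

(** Along such a walk [c u] would meet itself in measure at most [n * (k - 2) < 1]. *)
Lemma no_short_odd_closed_walk (G : graph) (k : R) (c : vtx G -> Rset) (u : vtx G) (n N : nat) :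
  fractional_coloring G k c -> 2 <= k < 2 + 1 / INR N -> (1 <= N)%nat -> (n <= N)%nat ->
  ~ walk G u u (S (2 * n)).
Proof.
  intros Hc Hk HN Hn Hw.
  destruct (coloring_along_walk G k c u u _ Hc ltac:(lra) Hw n) as [_ H].
  specialize (H eq_refl).
  replace (cap (c u) (c u)) with (c u) in H by set_solve.
  destruct Hc as [Hc _]. specialize (Hc u). apply unit_subset_iff in Hc.
  destruct Hc as [_ Hc].
  apply le_INR in HN, Hn. simpl in HN.
  assert (INR N * (k - 2) < 1).
  { apply Rlt_le_trans with (INR N * (1 / INR N)).
    - apply Rmult_lt_compat_l; lra.
    - right. field. lra. }
  nra.
Qed.

(** A relation, so that disconnected vertices simply have no distance. *)
Definition at_distance (G : graph) (u v : vtx G) (n : nat) : Prop :=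
  walk G u v n /\ dist_ge G u v n.

Lemma at_distance_exists (G : graph) (u v : vtx G) (n : nat) :
  walk G u v n -> exists i, (i <= n)%nat /\ at_distance G u v i.
Proof.
  induction n as [n IH] using Wf_nat.lt_wf_ind. intro H.
  destruct (classic (exists i, (i < n)%nat /\ walk G u v i)) as [[i [Hi Hw]]|Hno].
  - destruct (IH i Hi Hw) as [j [Hj Hd]]. exists j. split; [lia | exact Hd].
  - exists n. split; [lia|]. split; [exact H|]. intros i Hi.
    apply Nat.nlt_ge. intro. apply Hno. eauto.
Qed.

Lemma at_distance_unique (G : graph) (u v : vtx G) (n n' : nat) :
  at_distance G u v n -> at_distance G u v n' -> n = n'.
Proof.
  intros [H1 H2] [H1' H2']. apply H2 in H1'. apply H2' in H1. lia.
Qed.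

Lemma at_distance_adj (G : graph) (u v w : vtx G) (n n' : nat) :
  at_distance G w u n -> at_distance G w v n' -> adj G u v -> (n' <= S n)%nat.
Proof.
  intros [H _] [_ H'] Ha. apply H'. replace (S n) with (n + 1)%nat by lia.
  apply walk_trans with u; [exact H | apply walk_step, Ha].
Qed.

(** * Recolouring *)

(* [F] is the colouring used far from [W]; its colour sets are independent of
   all precolour sets, whatever the base colouring assigns to [W]. *)
Lemma generic_recoloring (G : graph) (k eps : R) (W : vtx G -> Prop) (f c : vtx G -> Rset) :
  fractional_coloring G k c -> fractional_precoloring G (k + eps) W f ->
  0 < k -> 0 <= eps ->
  exists (D : Rset) (F : vtx G -> Rset),
    mset (k + eps) D /\ mu D = k /\
    (forall w, W w -> mu (cap D (f w)) = 1 / (k + eps) * k) /\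
    (forall u v, adj G u v -> disjoint (F u) (F v)) /\
    (forall v, mset (k + eps) (F v) /\ subset (F v) D /\ mu (F v) = 1 /\
       forall w, W w -> mu (cap (F v) (f w)) = 1 / (k + eps)).
Proof.
  intros [Hc Hcd] Hf Hk Heps. set (m := k + eps).
  destruct (vtx_finite G) as [l Hl].
  assert (Hcm : forall v, mset k (c v) /\ mu (c v) = 1)
    by (intro; apply unit_subset_iff, Hc).
  assert (Hfm : forall v, W v -> mset m (f v) /\ mu (f v) = 1)
    by (intros v Hv; apply unit_subset_iff, Hf, Hv).
  (* Nothing is known of [f] outside [W]; the empty set there keeps the whole list measurable. *)
  set (f' := fun v t => W v /\ f v t).
  assert (Hf' : forall v, W v -> f' v = f v).
  { intros v Hv. apply set_ext. intro t. unfold f'. tauto. }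
  assert (Hf'm : forall v, lebesgue_measurable (f' v)).
  { intro v. destruct (classic (W v)) as [Hv|Hv].
    - rewrite Hf' by exact Hv. apply mset_measurable with m, Hfm, Hv.
    - apply measurable_empty. intros t [H _]. auto. }
  assert (HLT : forall Y, In Y (map f' l) -> lebesgue_measurable Y).
  { intros Y HY. apply in_map_iff in HY. destruct HY as [v [<- _]]. apply Hf'm. }
  assert (HLM : forall Y, In Y (map c l) -> lebesgue_measurable Y).
  { intros Y HY. apply in_map_iff in HY. destruct HY as [v [<- _]].
    apply mset_measurable with k, Hcm. }
  set (T := fun t => 0 <= t < m).
  assert (HT : mset m T) by apply mset_interval.
  assert (HmuT : mu T = m) by (apply mu_interval; unfold m; lra).
  destruct (uniform_family_exists _ HLT m T HT) as [R0 [MR [_ [_ [_ UR]]]]].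
  specialize (MR (k / m)). specialize (UR (k / m)).
  assert (Hkm : 0 <= k / m <= 1).
  { unfold m. split; [apply Rle_mult_inv_pos; lra | apply Rle_div_l; lra]. }
  set (D := cap T (R0 (k / m))) in *.
  assert (HD : mset m D) by (unfold D; auto with mset).
  assert (HDf : forall w, W w -> mu (cap D (f w)) = 1 / m * k).
  { intros w Hw. rewrite <- (Hf' w Hw). rewrite UR; [|exact Hkm|right; apply in_map, Hl].
    rewrite (Hf' w Hw). destruct (Hfm w Hw) as [[I _] H1].
    replace (cap T (f w)) with (f w)
      by (apply set_ext; intro t; specialize (I t); unfold T; set_unfold; tauto).
    rewrite H1. field. unfold m; lra. }
  assert (HmuD : mu D = k).
  { replace D with (cap D full) by set_solve.
    rewrite UR; [|exact Hkm|left; reflexivity].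
    replace (cap T full) with T by set_solve. rewrite HmuT. field. unfold m; lra. }
  (* The colours [[0, k)] of [c] are pulled back to [D], which holds the fraction [k / m] of every
     precolour set. *)
  destruct (transport_exists m k (map f' l) HLT (map c l) HLM D (fun t => 0 <= t < k)
              HD (mset_interval k)) as [phi [_ Htr]]; [exists 0; lra|].
  exists D, (fun v => preimage D phi (c v)).
  split; [exact HD|]. split; [exact HmuD|]. split; [exact HDf|]. split.
  - intros u v Huv t [[_ H1] [_ H2]]. apply (Hcd u v Huv (phi t)). auto.
  - intro v. destruct (Htr (c v)) as [Mv Tv]; [apply in_map, Hl|].
    rewrite mu_interval in Tv by lra.
    destruct (Hcm v) as [[I _] H1].
    replace (cap (fun t => 0 <= t < k) (c v)) with (c v) in Tv
      by (apply set_ext; intro t; specialize (I t); set_unfold; tauto).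
    rewrite H1 in Tv.
    split; [split; [intros t [Ht _]; apply HD, Ht | exact Mv]|].
    split; [intros t [Ht _]; exact Ht|]. split.
    + specialize (Tv full (or_introl eq_refl)).
      replace (cap (preimage D phi (c v)) full) with (preimage D phi (c v)) in Tv by set_solve.
      replace (cap D full) with D in Tv by set_solve.
      rewrite HmuD in Tv. apply Rmult_eq_reg_r with k; lra.
    + intros w Hw. specialize (Tv (f' w)). rewrite (Hf' w Hw), (HDf w Hw) in Tv.
      assert (In (f w) (full :: map f' l)) as Hin
        by (right; rewrite <- (Hf' w Hw); apply in_map, Hl).
      specialize (Tv Hin). apply Rmult_eq_reg_r with k; lra.
Qed.

(* [Q w] lists the palettes of [palette_exists], from the boundary of the ball of
   radius [2 n] around [w] inwards; the outside is coloured by [F]. *)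
Lemma glue_palettes (G : graph) (m : R) (n d : nat) (W : vtx G -> Prop)
    (f F : vtx G -> Rset) (Q : vtx G -> nat -> vtx G -> Rset) :
  (4 * n + 2 <= d)%nat -> (1 <= n)%nat ->
  (forall u i, (i <= 2 * n)%nat -> ~ walk G u u (S (2 * i))) ->
  (forall u v, W u -> W v -> u <> v -> dist_ge G u v d) ->
  fractional_precoloring G m W f ->
  (forall v, mset m (F v) /\ mu (F v) = 1) ->
  (forall u v, adj G u v -> disjoint (F u) (F v)) ->
  (forall w, W w ->
     (forall j v, mset m (Q w j v) /\ 1 <= mu (Q w j v)) /\
     (forall v, Q w 0%nat v = F v) /\
     (forall j u v, adj G u v -> disjoint (Q w j u) (Q w (S j) v)) /\
     (forall v, disjoint (Q w (2 * n)%nat v) (f w))) ->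
  precoloring_extends G m W f.
Proof.
  intros Hd Hn Hodd HW Hf HF HFd HQ.
  (* Gives both disjoint balls and no edges between them, as [2 * n + 1 + 2 * n < d]. *)
  assert (Huniq : forall w w' v i i', W w -> W w' -> walk G w v i -> walk G w' v i' ->
            (i + i' < d)%nat -> w = w').
  { intros w w' v i i' Hw Hw' H H' Hlt. apply NNPP. intro Hne.
    specialize (HW w w' Hw Hw' Hne (i + i')%nat).
    assert (walk G w w' (i + i')) by (apply walk_trans with v; [|apply walk_sym]; auto).
    specialize (HW H0). lia. }
  set (near := fun v w i => W w /\ at_distance G w v i /\ (i <= 2 * n)%nat).
  assert (Hnu : forall v w i w' i', near v w i -> near v w' i' -> w = w' /\ i = i').
  { intros v w i w' i' [Hw [Hi Hin]] [Hw' [Hi' Hin']].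
    assert (w = w') as <-.
    { apply Huniq with v i i'; auto; [apply Hi | apply Hi' | lia]. }
    split; [reflexivity|]. apply at_distance_unique with (1 := Hi) (2 := Hi'). }
  assert (Hself : forall v, W v -> near v v 0%nat).
  { intros v Hv. split; [exact Hv|]. split; [|lia].
    split; [apply walk0 | intros i _; lia]. }
  assert (Hzero : forall v w, near v w 0%nat -> w = v).
  { intros v w [_ [[H _] _]]. apply walk_zero, H. }
  assert (HC : forall v, exists C,
            unit_subset m C /\
            (W v -> C = f v) /\
            (forall w i, near v w i -> (1 <= i)%nat ->
               subset C (Q w (2 * n + 1 - i)%nat v)) /\
            ((forall w i, ~ near v w i) -> subset C (F v))).
  { intro v. destruct (classic (W v)) as [Hv|Hv].
    - exists (f v). split; [apply Hf, Hv|]. split; [auto|]. split.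
      + intros w i Hnear Hi. destruct (Hnu _ _ _ _ _ Hnear (Hself v Hv)). lia.
      + intro H. destruct (H v 0%nat (Hself v Hv)).
    - destruct (classic (exists w i, near v w i)) as [[w [i Hnear]]|Hno].
      + destruct (HQ w (proj1 Hnear)) as [HQm _].
        destruct (HQm (2 * n + 1 - i)%nat v) as [Hm H1].
        (* A palette may have measure above one and is cut down. *)
        destruct (subset_of_measure m 1 _ Hm) as [C [MC [SC EC]]]; [lra|].
        exists C. split; [apply unit_subset_iff; auto|]. split; [tauto|]. split.
        * intros w' i' Hnear' _.
          destruct (Hnu _ _ _ _ _ Hnear Hnear') as [<- <-]. exact SC.
        * intro H. destruct (H w i Hnear).
      + exists (F v). split; [apply unit_subset_iff, HF|]. split; [tauto|]. split.
        * intros w i Hnear. destruct Hno. eauto.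
        * intros _ t Ht. exact Ht. }
  apply choice in HC. destruct HC as [C HC].
  (* Edges leading away from [w]: [v] is one step further in the same ball, or in no ball at all. *)
  assert (Hkey : forall u v w i, adj G u v -> near u w i ->
            (forall i', near v w i' -> i' = S i) -> disjoint (C u) (C v)).
  { intros u v w i Huv Hnear Hnext.
    destruct (HC u) as [_ [CuW [CuQ _]]]. destruct (HC v) as [_ [_ [CvQ CvF]]].
    assert (Hw : W w) by apply Hnear.
    destruct (HQ w Hw) as [_ [Q0 [Qd QX]]].
    assert (Hwalk : walk G w v (i + 1)).
    { apply walk_trans with u; [apply Hnear | apply walk_step, Huv]. }
    assert (Hle : (i <= 2 * n)%nat) by apply Hnear.
    destruct (classic (exists w' i', near v w' i')) as [[w' [i' Hnear']]|Hno].
    - assert (w = w') as <-.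
      { apply Huniq with v (i + 1)%nat i'; auto; try apply Hnear'.
        destruct Hnear' as [_ [_ Hi']]. lia. }
      rewrite (Hnext i' Hnear') in Hnear'. clear i'.
      assert (Hle' : (S i <= 2 * n)%nat) by apply Hnear'.
      specialize (CvQ w (S i) Hnear' ltac:(lia)).
      destruct i as [|i].
      + assert (w = u) as -> by (apply Hzero, Hnear). rewrite (CuW Hw).
        replace (2 * n + 1 - 1)%nat with (2 * n)%nat in CvQ by lia.
        intros t [H1 H2]. apply (QX v t). auto.
      + specialize (CuQ w (S i) Hnear ltac:(lia)).
        replace (2 * n + 1 - S i)%nat with (S (2 * n + 1 - S (S i)))%nat in CuQ by lia.
        intros t [H1 H2]. apply (Qd (2 * n + 1 - S (S i))%nat v u (adj_sym G _ _ Huv) t).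
        auto.
    (* An edge leaving the ball starts on its boundary, where [u] uses palette [1]; [v] uses [F v],
       which is palette [0]. *)
    - assert (i = 2 * n)%nat as ->.
      { destruct (at_distance_exists G w v (i + 1) Hwalk) as [j [Hj Hdj]].
        apply NNPP. intro. apply Hno. exists w, j. split; [exact Hw|].
        split; [exact Hdj | lia]. }
      specialize (CuQ w (2 * n)%nat Hnear ltac:(lia)).
      replace (2 * n + 1 - 2 * n)%nat with 1%nat in CuQ by lia.
      assert (Hvn : forall w' i', ~ near v w' i') by (intros w' i' H; apply Hno; eauto).
      specialize (CvF Hvn). rewrite <- (Q0 v) in CvF.
      intros t [H1 H2]. apply (Qd 0%nat v u (adj_sym G _ _ Huv) t). auto. }
  exists C. split; [split|].
  - intro v. apply HC.
  - assert (Hsym : forall u v, disjoint (C v) (C u) -> disjoint (C u) (C v))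
      by (intros u v H t Ht; apply (H t); tauto).
    intros u v Huv. pose proof (adj_sym G _ _ Huv) as Hvu.
    destruct (classic (exists w i, near u w i)) as [[w [i Hnear]]|Hno].
    + destruct (classic (exists i', near v w i')) as [[i' Hnear']|Hno'].
      * assert (i' <= S i)%nat.
        { apply at_distance_adj with (3 := Huv) (w := w); [apply Hnear | apply Hnear']. }
        assert (i <= S i')%nat.
        { apply at_distance_adj with (3 := Hvu) (w := w); [apply Hnear' | apply Hnear]. }
        assert (i <> i').
        (* Equal distances would close a walk of length [2 * i' + 1] through [w]. *)
        { intros ->. apply (Hodd w i'); [apply Hnear|].
          replace (S (2 * i')) with (i' + (1 + i'))%nat by lia.
          apply walk_trans with u; [apply Hnear|].
          apply walk_trans with v; [apply walk_step, Huv|].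
          apply walk_sym, Hnear'. }
        assert (Hc : i' = S i \/ i = S i') by lia. destruct Hc as [->| ->].
        -- apply Hkey with w i; auto. intros j Hj. apply (Hnu _ _ _ _ _ Hj Hnear').
        -- apply Hsym, Hkey with w i'; auto. intros j Hj. apply (Hnu _ _ _ _ _ Hj Hnear).
      * apply Hkey with w i; auto. intros j Hj. destruct Hno'. eauto.
    + destruct (classic (exists w i, near v w i)) as [[w [i Hnear]]|Hno'].
      * apply Hsym, Hkey with w i; auto. intros j Hj. destruct Hno. eauto.
      * intros t [H1 H2]. apply (HFd u v Huv t). split.
        -- apply (proj2 (proj2 (proj2 (HC u)))); [intros w i H; apply Hno; eauto | exact H1].
        -- apply (proj2 (proj2 (proj2 (HC v)))); [intros w i H; apply Hno'; eauto | exact H2].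
  - intros v Hv t. destruct (HC v) as [_ [CW _]]. rewrite (CW Hv). tauto.
Qed.

Theorem mainTheorem11 (d : nat) (k : Q) (eps : R) :
  (6 <= d)%nat -> (d mod 4 = 2)%nat ->
  0 < eps ->
  2 <= Q2R k < 2 + 1 / (2 * INR (d / 4)) ->
  eps * sum_f_R0 (fun j => (Q2R k - 1) ^ (2 * j + 1)) (d / 4 - 1) >= 1 / (Q2R k + eps) ->
  forall (G : graph) (W : vtx G -> Prop),
    fractionally_colorable G (Q2R k) ->
    (forall u v, W u -> W v -> u <> v -> dist_ge G u v d) ->
    forall f, fractional_precoloring G (Q2R k + eps) W f ->
      precoloring_extends G (Q2R k + eps) W f.
Proof.
  intros Hd Hmod Heps Hk Hsum G W [c Hc] HW f Hf.
  set (r := Q2R k) in *. set (n := (d / 4)%nat) in *.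
  assert (Hdn : d = (4 * n + 2)%nat).
  { pose proof (Nat.div_mod_eq d 4). unfold n. lia. }
  assert (Hn : (1 <= n)%nat) by lia.
  rewrite slack_sum in Hsum. replace (S (n - 1)) with n in Hsum by lia.
  assert (Hp : 0 < 1 / (r + eps) < 1).
  { split; [apply Rdiv_lt_0_compat; lra | apply Rlt_div_l; lra]. }
  assert (Hpm : 1 / (r + eps) * (r + eps) = 1) by (field; lra).
  set (p := 1 / (r + eps)) in *.
  destruct (generic_recoloring G r eps W f c Hc Hf) as [D [F [HD [HmuD [HDf [HFd HF]]]]]];
    [lra | lra |]. fold p in HDf, HF.
  destruct (vtx_finite G) as [l Hl].
  set (S := diff (fun t => 0 <= t < r + eps) D).
  assert (HS : mset (r + eps) S).
  { apply mset_diff; [apply mset_interval | eauto with mset]. }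
  assert (HmuS : mu S = eps).
  { pose proof (mu_mset_split (r + eps) D _ (mset_interval _) (mset_measurable _ _ HD)) as E.
    rewrite mu_interval in E by lra. fold S in E.
    replace (cap (fun t => 0 <= t < r + eps) D) with D in E.
    - lra.
    - destruct HD as [I _]. apply set_ext. intro t. specialize (I t). set_unfold. tauto. }
  assert (Hpal : forall w, exists Q : nat -> vtx G -> Rset, W w ->
     (forall j v, mset (r + eps) (Q j v) /\ 1 <= mu (Q j v)) /\
     (forall v, Q 0%nat v = F v) /\
     (forall j u v, adj G u v -> disjoint (Q j u) (Q (Datatypes.S j) v)) /\
     (forall v, disjoint (Q (2 * n)%nat v) (f w))).
  { intro w. destruct (classic (W w)) as [Hw|Hw]; [|exists (fun _ _ => full); tauto].
    (* From [p * (r + eps) = 1]: [p * r <= 1 <= r - 1], and [1 - p = (r - 1) * p + eps * p] with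
       [p < 1]. *)
    destruct (palette_exists (r + eps) r p eps (vtx G) l (adj G) F D S (f w) n)
      as [Q HQ]; auto; try lra; try nra.
    - apply unit_subset_iff, Hf, Hw.
    - unfold S. intro t. set_unfold. tauto.
    - intro v. destruct (HF v) as [H1 [H2 [H3 H4]]]. auto.
    - exists Q. auto. }
  apply choice in Hpal. destruct Hpal as [Q HQ].
  apply glue_palettes with n d F Q; auto.
  - lia.
  - intros u i Hi. apply no_short_odd_closed_walk with r c (2 * n)%nat; auto; [|lia].
    rewrite mult_INR. simpl (INR 2). exact Hk.
  - intro v. destruct (HF v) as [H1 [_ [H2 _]]]. auto.
Qed.
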